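(* For every integer $n\ge 1$, let $Q_n$ be the orthogonal projection from the edge space of the Hamming cube $\mathbb{Z}_2^n$ onto the cut space of $\mathbb{Z}_2^n$. Then $\|Q_n\|_1=\dfrac{n+1}{2}$.
   Context: The Hamming cube $\mathbb{Z}_2^n$ is the graph with vertex set $\{0,1\}^n$ in which two vertices are adjacent if and only if they differ in exactly one coordinate; let $V$ and $E$ be its vertex and edge sets. Fix an orientation of the edges (tail $e^-$, head $e^+$). The edge space is $\mathbb{R}^E$; the cycle space is $\{F\in\mathbb{R}^E:\ \sum_{e^+=v}F(e)=\sum_{e^-=v}F(e)\text{ for all }v\in V\}$ and the cut space is its orthogonal complement in $\mathbb{R}^E$ with respect to the standard inner product. $\|T\|_1$ denotes the operator norm of $T:\ell_1(E)\to\ell_1(E)$, where $\ell_1(E)$ is $\mathbb{R}^E$ with the $\ell_1$-norm. *)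

(* Defs.v *)
From HB Require Import structures.
From mathcomp Require Import all_boot all_order all_algebra.
From mathcomp Require Import boolp classical_sets reals.

Set Implicit Arguments.
Unset Strict Implicit.
Unset Printing Implicit Defensive.

Import Order.TTheory GRing.Theory Num.Theory.
Local Open Scope ring_scope.

(* R^o (convertible to R) carries the vectType structure, so {ffun I -> R^o}
   is R^I as a finite-dimensional vector space. *)
Notation real_space R I := {ffun I -> R^o}.

Section InnerProduct.
Variables (R : realType) (I : finType).

Definition dotf (F G : real_space R I) : R := \sum_(i : I) F i * G i.

Fact dotf_is_bilinear :
  bilinear_for *%R%R ((@idfun R) \; *%R : R -> R -> R) dotf.
Proof.
rewrite /dotf; split=> [G a F H|F a G H] /=; rewrite mulr_sumr -big_split /=;
  apply: eq_bigr => i _; rewrite !ffunE.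
- by rewrite mulrDl -[a *: _]/(a * _) mulrA.
- by rewrite mulrDr -[a *: _]/(a * _) mulrCA.
Qed.

HB.instance Definition _ := @bilinear_isBilinear.Build R
  (real_space R I) (real_space R I) R *%R (@idfun R \; *%R) dotf
  dotf_is_bilinear.

Fact dotf_sym F G : dotf F G = (-1) ^+ false * idfun (dotf G F).
Proof. by rewrite mul1r; apply: eq_bigr => i _; rewrite mulrC. Qed.

HB.instance Definition _ :=
  isHermitianSesquilinear.Build R (real_space R I) false idfun dotf dotf_sym.

Fact dotf_gt0 F : F != 0 -> 0 < dotf F F.
Proof.
move=> F0; rewrite lt0r sumr_ge0 ?andbT => [|i _]; last exact: sqr_ge0.
apply: contraNneq F0 => /psumr_eq0P F0; apply/eqP/ffunP => i; rewrite ffunE.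
have /eqP := F0 (fun i _ => sqr_ge0 (F i)) i isT.
by rewrite mulf_eq0 orbb => /eqP.
Qed.

HB.instance Definition _ := isDotProduct.Build R (real_space R I) dotf dotf_gt0.

Definition l1norm (F : real_space R I) : R := \sum_(i : I) `|F i|.

Definition l1opnorm (T : 'End(real_space R I)) : R :=
  sup [set l1norm (T F) | F in [set F : real_space R I | l1norm F <= 1]]%classic.

Definition ortho_compl (U : {vspace real_space R I}) : {vspace real_space R I} :=
  orthov dotf U.

(* The projection onto U along its orthogonal complement; ortho_projP below
   gives the usual characterization. *)
Definition ortho_proj (U : {vspace real_space R I}) : 'End(real_space R I) :=
  daddv_pi U (ortho_compl U).

Lemma ortho_compl_disjoint U : (U :&: ortho_compl U = 0)%VS.
Proof.
apply/eqP; rewrite -subv0; apply/subvP => F; rewrite memv_cap memv0.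
move=> /andP[FU /mem_orthovP /(_ F FU) FF].
by apply: contraT => /dotf_gt0; rewrite [dotf F F]FF ltxx.
Qed.

Lemma ortho_compl_add U : (U + ortho_compl U = fullv)%VS.
Proof.
pose b := vbasis U.
pose c (F : real_space R I) : 'rV[R]_(\dim U) := \row_i dotf F b`_i.
have c_lin : linear c.
  move=> a F G; apply/rowP => i; rewrite !mxE.
  exact: (dotf_is_bilinear.1 b`_i a F G).
pose cL : {linear real_space R I -> 'rV[R]_(\dim U)} :=
  HB.pack c (GRing.isLinear.Build _ _ _ _ c c_lin).
have kerc : (lker (linfun cL) <= ortho_compl U)%VS.
  apply/subvP => F; rewrite memv_ker lfunE /= => /eqP/rowP F0.
  apply/mem_orthovP => G /coord_vbasis ->.
  rewrite linear_sumr big1 // => i _; rewrite linearZr /=.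
  by have := F0 i; rewrite !mxE => ->; rewrite mulr0.
apply/eqP; rewrite eqEdim subvf /= dimv_disjoint_sum ?ortho_compl_disjoint //.
rewrite -(limg_ker_dim (linfun cL) fullv) capfv addnC leq_add ?dimvS //.
by apply: leq_trans (dimvS (subvf _)) _; rewrite dimvf /dim /= mul1n.
Qed.

Lemma ortho_projP U F P :
  P = ortho_proj U F <->
  P \in U /\ (forall G, G \in U -> dotf (F - P) G = 0).
Proof.
have dis := ortho_compl_disjoint U.
have dis' : (ortho_compl U :&: U = 0)%VS by rewrite capvC.
have Fadd : F \in (U + ortho_compl U)%VS by rewrite ortho_compl_add memvf.
have FE := daddv_pi_add dis Fadd.
split=> [->|[PU PG]].
  split=> [|G GU]; first exact: memv_pi.
  rewrite -{1}FE addrC addKr.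
  by apply/(mem_orthovP (form := dotf)): G GU; apply: memv_pi.
have FP : F - P \in ortho_compl U by apply/mem_orthovP.
have {1}-> : P = ortho_proj U P by rewrite /ortho_proj daddv_pi_id.
apply/eqP; rewrite eq_sym -subr_eq0 -linearB /=.
have FPadd : F - P \in (U + ortho_compl U)%VS by rewrite ortho_compl_add memvf.
have := daddv_pi_add dis FPadd.
by rewrite (daddv_pi_id dis' FP) -{3}[F - P]add0r => /addIr/eqP.
Qed.

End InnerProduct.

Definition vertex (n : nat) := {ffun 'I_n -> bool}.

Definition cube_adj n (u v : vertex n) : bool := #|[set i | u i != v i]| == 1%N.

Definition is_edge n (e : {set vertex n}) : bool :=
  [exists u, exists v, cube_adj u v && (e == [set u; v])].

Definition edge (n : nat) := {e : {set vertex n} | is_edge e}.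

(* An edge is an unordered pair of adjacent vertices, so this equation makes
   tail and head its two distinct endpoints, in one of the two orders. *)
Record orientation (n : nat) := Orientation {
  tail : edge n -> vertex n;
  head : edge n -> vertex n;
  orientationE : forall e, val e = [set tail e; head e] }.

Lemma orientation_exists n : inhabited (orientation n).
Proof.
have ends (e : edge n) : {p : vertex n * vertex n | val e == [set p.1; p.2]}.
  apply: sigW; have /existsP[u /existsP[v /andP[_ euv]]] := valP e.
  by exists (u, v).
exists; apply: (@Orientation n (fun e => (sval (ends e)).1)
  (fun e => (sval (ends e)).2)) => e.
exact/eqP/(svalP (ends e)).
Qed.

Section CycleCut.
Variables (R : realType) (n : nat) (o : orientation n).

Definition net_flow (F : real_space R (edge n)) : real_space R (vertex n) :=
  [ffun v => \sum_(e | head o e == v) F e - \sum_(e | tail o e == v) F e].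

Fact net_flow_is_linear : linear net_flow.
Proof.
move=> a F G; apply/ffunP => v; rewrite !ffunE.
under eq_bigr do rewrite !ffunE; rewrite big_split /= -scaler_sumr.
under [X in _ - X]eq_bigr do rewrite !ffunE.
by rewrite big_split /= -scaler_sumr scalerBr opprD addrACA.
Qed.

HB.instance Definition _ :=
  GRing.isLinear.Build R (real_space R (edge n)) (real_space R (vertex n)) _
    net_flow net_flow_is_linear.

Definition cycle_space : {vspace real_space R (edge n)} := lker (linfun net_flow).

Lemma cycle_spaceP F :
  F \in cycle_space <->
  forall v, \sum_(e | head o e == v) F e = \sum_(e | tail o e == v) F e.
Proof.
rewrite memv_ker lfunE /=; split=> [/eqP/ffunP F0 v|F0].
  by have := F0 v; rewrite !ffunE => /eqP; rewrite subr_eq0 => /eqP.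
by apply/eqP/ffunP => v; rewrite !ffunE F0 subrr.
Qed.

Definition cut_space : {vspace real_space R (edge n)} := ortho_compl cycle_space.

Definition cut_proj : 'End(real_space R (edge n)) := ortho_proj cut_space.

End CycleCut.

Arguments cut_proj R {n} o.

(* Main.v *)
(* Fix an edge {u, v} in direction j.  Its projection onto the cut space is the
   gradient of a potential phi, antisymmetric under the flip of coordinate j,
   whose Laplacian is the dipole delta_u - delta_v.  A minimum principle applied
   to the discrete derivatives of phi shows that the derivative in direction i
   has at x the sign tau_i(x), the product of (-1)^(x_k + u_k) over k in {i, j}.
   Since tau_i is an eigenfunction of the Laplacian, with eigenvalue
   2 #|{i, j}|, self-adjointness turns the l1-norm of this derivative into a
   value of the dipole against tau_i: direction j contributes 1 and each other
   direction 1/2.  Hence every column of the projection has l1-norm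
   1 + (n - 1) / 2, and the l1 operator norm is the largest column norm. *)

Require Import Defs.
From HB Require Import structures.
From mathcomp Require Import classical_sets.
From mathcomp Require Import all_boot all_order all_algebra reals.
From mathcomp Require Import ring lra.

Set Implicit Arguments.
Unset Strict Implicit.
Unset Printing Implicit Defensive.

Import Order.TTheory GRing.Theory Num.Theory.
Local Open Scope ring_scope.

(** * Coordinate flips and the edges of the cube *)

Section Flip.
Variable n : nat.
Implicit Types (x u : vertex n) (i j l : 'I_n).

Definition flip i x : vertex n := [ffun k => x k (+) (k == i)].

Lemma flipK i : involutive (flip i).
Proof. by move=> x; apply/ffunP => k; rewrite !ffunE -addbA addbb addbF. Qed.

Lemma flipC i j x : flip i (flip j x) = flip j (flip i x).
Proof. by apply/ffunP => k; rewrite !ffunE addbAC. Qed.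

Lemma flip_injl x : injective (fun i => flip i x).
Proof.
move=> i j /ffunP /(_ i); rewrite !ffunE eqxx => /addbI /esym.
exact/eqP.
Qed.

Lemma flip_neq i x : (x == flip i x) = false.
Proof.
apply/eqP => /ffunP /(_ i); rewrite ffunE eqxx addbT.
by case: (x i).
Qed.

Lemma flip_eq i x u : (flip i x == u) = (x == flip i u).
Proof. exact: (can2_eq (flipK i) (flipK i)). Qed.

Lemma cube_adj_flip i x : cube_adj x (flip i x).
Proof.
apply/cards1P; exists i; apply/setP => k; rewrite !inE ffunE.
by case: (x k); case: (k == i).
Qed.

Lemma cube_adjP x u : reflect (exists i, u = flip i x) (cube_adj x u).
Proof.
apply: (iffP idP) => [/cards1P[i /setP xu]|[i ->]]; last exact: cube_adj_flip.
exists i; apply/ffunP => k; rewrite ffunE; have := xu k; rewrite !inE => <-.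
by case: (x k); case: (u k).
Qed.

Lemma edge_at_subproof x i : is_edge [set x; flip i x].
Proof.
by apply/existsP; exists x; apply/existsP; exists (flip i x);
  rewrite cube_adj_flip eqxx.
Qed.

Definition edge_at x i : edge n := Sub [set x; flip i x] (edge_at_subproof x i).

Lemma edge_atP x (e : edge n) :
  reflect (exists i, e = edge_at x i) (x \in val e).
Proof.
apply: (iffP idP) => [|[i ->]]; last by rewrite !inE eqxx.
have /existsP[a /existsP[b /andP[/cube_adjP[i ->] /eqP eE]]] := valP e.
rewrite eE !inE => /orP[] /eqP xE; exists i; apply/val_inj; rewrite eE /= xE //.
by rewrite flipK setUC.
Qed.

Lemma edge_at_inj x : injective (edge_at x).
Proof.
move=> i k /(congr1 val) /= /setP /(_ (flip i x)).
by rewrite !inE eqxx orbT eq_sym flip_neq /= => /esym/eqP/flip_injl.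
Qed.

Lemma sum_edges_at (V : nmodType) (f : edge n -> V) x :
  \sum_(e : edge n | x \in val e) f e = \sum_i f (edge_at x i).
Proof.
rewrite -(big_imset f (h := edge_at x) (A := predT)) /=; last first.
  by move=> i k _ _; apply: edge_at_inj.
apply: eq_bigl => e; apply/edge_atP/imsetP => [[i ->]|[i _ ->]]; by exists i.
Qed.

Lemma card_edge (e : edge n) : #|val e| = 2.
Proof.
have /existsP[a /existsP[b /andP[/cube_adjP[i ->] /eqP ->]]] := valP e.
by rewrite cards2 flip_neq.
Qed.

(** Double counting: every edge is met once from each of its two endpoints. *)
Lemma sum_edges (V : nmodType) (f : edge n -> V) :
  (\sum_e f e) *+ 2 = \sum_x \sum_i f (edge_at x i).
Proof.
under [RHS]eq_bigr do rewrite -sum_edges_at.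
rewrite (exchange_big_dep predT) //= -sumrMnl; apply: eq_bigr => e _.
by rewrite sumr_const card_edge.
Qed.

End Flip.

(** * The Laplacian of the cube and the potential of a dipole *)

Section Laplacian.
Variables (R : realType) (n : nat).
Implicit Types (f g w : vertex n -> R) (x : vertex n) (i j l : 'I_n).

Definition laplacian f x : R := \sum_l (f x - f (flip l x)).

Lemma sum_flip f i : \sum_x f (flip i x) = \sum_x f x.
Proof. by rewrite [RHS](reindex_inj (inv_inj (flipK i))). Qed.

Lemma laplacian_sym f g :
  \sum_x laplacian f x * g x = \sum_x f x * laplacian g x.
Proof.
rewrite /laplacian; under eq_bigr do rewrite mulr_suml.
under [RHS]eq_bigr do rewrite mulr_sumr.
rewrite exchange_big [RHS]exchange_big; apply: eq_bigr => l _ /=.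
under eq_bigr do rewrite mulrBl.
under [RHS]eq_bigr do rewrite mulrBr.
rewrite !sumrB; congr (_ - _).
by rewrite -(sum_flip _ l); under eq_bigr do rewrite flipK.
Qed.

(** At a minimizer of [w] every difference in the sum is at most 0, so the hypothesis forces
    [c * w x] to be nonnegative there. *)
Lemma minimum_principle (P : pred 'I_n) (c : R) w : 0 < c ->
  (forall x, 0 <= c * w x + \sum_(l | P l) (w x - w (flip l x))) ->
  forall x, 0 <= w x.
Proof.
move=> c0 wP x0.
case: (@Order.TotalTheory.arg_minP _ _ _ x0 xpredT w isT) => x _ xmin.
apply: le_trans (xmin x0 isT); rewrite -(pmulr_rge0 _ c0).
apply: le_trans (wP x) _; rewrite gerDl sumr_le0 // => l _.
by rewrite subr_le0 xmin.
Qed.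

Variables (u : vertex n) (j : 'I_n).

Definition dipole x : R := (x == u)%:R - (x == flip j u)%:R.

Definition sign i x : R := (-1) ^+ (x i (+) u i).

Lemma sign_flip i l x : sign i (flip l x) = (-1) ^+ (i == l) * sign i x.
Proof. by rewrite /sign ffunE addbAC -signr_addb addbC. Qed.

(* The common sign of the derivative in direction i, tau_i in the header. *)
Definition edge_sign i x : R := sign j x * (if i == j then 1 else sign i x).

Lemma edge_sign_flip i l x :
  edge_sign i (flip l x) = (-1) ^+ (l \in pred2 i j) * edge_sign i x.
Proof.
rewrite /edge_sign !sign_flip inE /= ![l == _]eq_sym.
case: (altP (i =P j)) => [->|ij]; first by rewrite orbb !mulr1.
case: (altP (i =P l)) => [il|_] /=; last by rewrite mul1r mulrA.
by rewrite -il eq_sym (negPf ij) /=; ring.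
Qed.

Lemma edge_sign_start i : edge_sign i u = 1.
Proof. by rewrite /edge_sign /sign !addbb; case: ifP; rewrite mul1r. Qed.

Lemma normr_edge_sign i x : `|edge_sign i x| = 1.
Proof.
by rewrite /edge_sign /sign; case: ifP; rewrite normrM ?normr1 !normr_sign ?mul1r.
Qed.

Lemma dipole_edge_sign i x :
  dipole x * edge_sign i x = (x == u)%:R + (x == flip j u)%:R.
Proof.
rewrite /dipole; case: (altP (x =P u)) => [->|_].
  by rewrite flip_neq edge_sign_start /=; ring.
case: (altP (x =P _)) => [->|_]; last by rewrite /=; ring.
by rewrite edge_sign_flip !inE eqxx orbT edge_sign_start /=; ring.
Qed.

(** A flip in direction [i] or [j] negates the sign and so contributes twice its value; any other
    flip fixes it and contributes nothing. *)
Lemma laplacian_edge_sign i x :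
  laplacian (edge_sign i) x = (2 * #|pred2 i j|)%:R * edge_sign i x.
Proof.
rewrite /laplacian (bigID (mem (pred2 i j))) /= [X in _ + X]big1 => [|l /negPf lij].
  rewrite addr0 (eq_bigr (fun=> edge_sign i x *+ 2)) => [|l lij].
    by rewrite sumr_const -mulrnA mulr_natl.
  by rewrite edge_sign_flip lij; ring.
by rewrite edge_sign_flip lij mul1r subrr.
Qed.

Lemma dipole_potential : exists2 phi : vertex n -> R,
  forall x, phi (flip j x) = - phi x & laplacian phi =1 dipole.
Proof.
(* Unlike the laplacian, L is injective; psi below is its Green function at u. *)
pose L (f : real_space R (vertex n)) : real_space R (vertex n) :=
  [ffun x => 2 * f x + \sum_(l | l != j) (f x - f (flip l x))].
have L_lin : linear L.
  move=> a f g; apply/ffunP => x; rewrite !ffunE.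
  under eq_bigr do rewrite !ffunE opprD addrACA -scalerBr.
  by rewrite big_split /= -scaler_sumr /GRing.scale /=; ring.
pose LL : {linear real_space R (vertex n) -> real_space R (vertex n)} :=
  HB.pack L (GRing.isLinear.Build _ _ _ _ L L_lin).
(* Injectivity of [L]: the minimum principle applies to both [f] and [- f] when [L f = 0]. *)
have ge0 (f : real_space R (vertex n)) : L f = 0 -> forall x, 0 <= f x.
  move=> /ffunP Lf0; apply: (@minimum_principle (fun l => l != j) 2) => // x.
  by have := Lf0 x; rewrite !ffunE => ->.
have kerL : lker (linfun LL) == 0%VS.
  rewrite -subv0; apply/subvP => f; rewrite memv_ker lfunE memv0 /= => /eqP Lf0.
  have LNf0 : L (- f) = 0 by rewrite -[L _]/(LL _) linearN /= Lf0 oppr0.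
  apply/eqP/ffunP => x; apply/le_anti; rewrite ffunE (ge0 _ Lf0) andbT.
  by have := ge0 _ LNf0 x; rewrite ffunE oppr_ge0.
pose psi := ((linfun LL)^-1)%VF [ffun x => (x == u)%:R].
have psiE x : 2 * psi x + \sum_(l | l != j) (psi x - psi (flip l x)) = (x == u)%:R.
  have := lker0_lfunVK kerL [ffun x => (x == u)%:R].
  by rewrite lfunE /= => /ffunP /(_ x); rewrite !ffunE.
(* L commutes with flip j, and L = laplacian on flip-antisymmetric functions. *)
exists (fun x => psi x - psi (flip j x)) => x; first by rewrite flipK opprB.
rewrite /laplacian /dipole -flip_eq -(psiE x) -(psiE (flip j x)).
rewrite (bigD1 j) //= flipK.
have -> : \sum_(l | l != j) (psi x - psi (flip j x) -
      (psi (flip l x) - psi (flip j (flip l x)))) =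
    \sum_(l | l != j) (psi x - psi (flip l x)) -
    \sum_(l | l != j) (psi (flip j x) - psi (flip l (flip j x))).
  by rewrite -sumrB; apply: eq_bigr => l _; rewrite flipC; ring.
ring.
Qed.

(** The sum runs over vertices, so each edge of direction [i] is counted twice; the factor is
    [#|pred2 i j|], namely 1 if [i = j] and 2 otherwise. *)
Lemma dipole_potential_grad i (phi : vertex n -> R) :
  (forall x, phi (flip j x) = - phi x) -> laplacian phi =1 dipole ->
  (\sum_x `|phi x - phi (flip i x)|) *+ (i != j).+1 = 2.
Proof.
move=> phi_anti phi_lap.
pose h x := phi x - phi (flip i x); pose w x := h x * edge_sign i x.
have h_lap x : laplacian h x = dipole x - dipole (flip i x).
  rewrite -!phi_lap /laplacian -sumrB; apply: eq_bigr => l _.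
  by rewrite /h flipC; ring.
have h_anti x l : l \in pred2 i j -> h (flip l x) = - h x.
  rewrite /h => /orP[] /eqP ->; first by rewrite flipK opprB.
  by rewrite flipC !phi_anti opprB opprK addrC.
(* In the directions [i] and [j] both [h] and the sign are negated, so the Laplacian of [h] leaves a
   multiple of [w x]; in the other directions the sign is constant and can be moved inside the
   differences. This is the form required by the minimum principle. *)
have w_lap x : (2 * #|pred2 i j|)%:R * w x +
    \sum_(l | l \notin pred2 i j) (w x - w (flip l x)) =
    laplacian h x * edge_sign i x.
  rewrite /laplacian mulr_suml [RHS](bigID (mem (pred2 i j))) /=; congr (_ + _).
    rewrite (eq_bigr (fun=> w x *+ 2)) => [|l lij].
      by rewrite sumr_const -mulrnA mulr_natl.
    by rewrite h_anti // /w; ring.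
  by apply: eq_bigr => l /negPf lij; rewrite /w edge_sign_flip lij; ring.
have dipole_ge0 x : 0 <= dipole x * edge_sign i x.
  by rewrite dipole_edge_sign addr_ge0.
have w_ge0 : forall x, 0 <= w x.
  apply: (@minimum_principle (fun l => l \notin pred2 i j)
    (2 * #|pred2 i j|)%:R) => [|x].
    by rewrite ltr0n card2.
  rewrite w_lap h_lap.
  (* The minus sign before [dipole (flip i x)] is absorbed by the change of sign under [flip i]. *)
  have := addr_ge0 (dipole_ge0 x) (dipole_ge0 (flip i x)).
  by rewrite edge_sign_flip !inE eqxx /= expr1 mulN1r mulrN [X in _ -> 0 <= X]mulrBl.
(* Since [w] is nonnegative, it is the absolute value of [h]; reindexing by [flip i] makes the two
   halves of its sum equal. *)
have -> : \sum_x `|phi x - phi (flip i x)| = (\sum_x phi x * edge_sign i x) *+ 2.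
  transitivity (\sum_x w x).
    apply: eq_bigr => x _; rewrite -[RHS]ger0_norm ?w_ge0 // normrM.
    by rewrite normr_edge_sign mulr1.
  rewrite /w /h; under eq_bigr do rewrite mulrBl; rewrite sumrB mulr2n; congr (_ + _).
  rewrite -sumrN -(sum_flip _ i); apply: eq_bigr => x _.
  by rewrite flipK edge_sign_flip !inE eqxx; ring.
have sum_eq1 (y : vertex n) : \sum_x (x == y)%:R = 1 :> R.
  by rewrite (bigD1 y) //= eqxx big1 ?addr0 // => x /negPf ->.
(* The left side pairs the dipole with the sign, giving 1 at each of its two vertices; the right
   side is the eigenvalue times the sum sought. *)
have := laplacian_sym phi (edge_sign i).
under eq_bigr do rewrite phi_lap dipole_edge_sign.
under [X in _ = X -> _]eq_bigr do rewrite laplacian_edge_sign mulrCA.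
by rewrite -mulr_sumr mulr_natl big_split /= !sum_eq1 card2 mulrnA => <-.
Qed.

End Laplacian.

(** * The l1 operator norm through column norms *)

Section Norm.
Variables (R : realType) (I : finType).
Implicit Types (F : real_space R I) (T : 'End(real_space R I)).

Definition basis_vec (i : I) : real_space R I := [ffun k => (k == i)%:R].

Lemma l1normD F G : l1norm (F + G) <= l1norm F + l1norm G.
Proof.
rewrite /l1norm -big_split; apply: ler_sum => i _; rewrite ffunE.
exact: ler_normD.
Qed.

Lemma l1normZ a F : l1norm (a *: F) = `|a| * l1norm F.
Proof.
rewrite /l1norm mulr_sumr; apply: eq_bigr => i _; rewrite ffunE.
exact: normrM.
Qed.

Lemma l1norm_basis_vec i : l1norm (basis_vec i) = 1.
Proof.
rewrite /l1norm (bigD1 i) //= big1 => [|k /negPf ki].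
  by rewrite ffunE eqxx normr1 addr0.
by rewrite ffunE ki normr0.
Qed.

Lemma basis_vec_expansion F : F = \sum_i F i *: basis_vec i.
Proof.
apply/ffunP => k; rewrite sum_ffunE (bigD1 k) //= big1 => [|i /negPf ik].
  by rewrite !ffunE eqxx addr0 /GRing.scale /= mulr1.
by rewrite !ffunE eq_sym ik scaler0.
Qed.

Lemma l1norm_le_columns T c F : (forall i, l1norm (T (basis_vec i)) <= c) ->
  l1norm (T F) <= c * l1norm F.
Proof.
move=> Tc; rewrite {1}(basis_vec_expansion F) linear_sum /= [c * _]mulrC mulr_suml.
elim/big_rec2: _ => [|i y1 y2 _ IH].
  by rewrite /l1norm big1 // => i _; rewrite ffunE normr0.
apply: le_trans (l1normD _ _) _; apply: lerD => //.
by rewrite linearZ /= l1normZ ler_wpM2l.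
Qed.

(** The column at [i0] attains the bound [c]. Without any index the operator norm would be 0,
    whatever [c] is. *)
Lemma l1opnorm_columns T c (i0 : I) :
  (forall i, l1norm (T (basis_vec i)) = c) -> l1opnorm T = c.
Proof.
move=> Tc; have c_ge0 : 0 <= c by rewrite -(Tc i0) sumr_ge0.
have c_ub : ubound [set l1norm (T F) | F in [set F | l1norm F <= 1]]%classic c.
  move=> _ [F /= F1 <-]; apply: le_trans (_ : c * l1norm F <= c).
    by apply: l1norm_le_columns => i; rewrite Tc.
  by rewrite ler_piMr.
have c_in : [set l1norm (T F) | F in [set F | l1norm F <= 1]]%classic c.
  by exists (basis_vec i0); rewrite /= ?l1norm_basis_vec.
apply/le_anti/andP; split; first by apply: ge_sup => //; exists c.
by apply: ub_le_sup => //; exists c.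
Qed.

End Norm.

(** * Gradients as cuts, and the columns of the projection *)

Section Gradient.
Variables (R : realType) (n : nat) (o : orientation n).
Implicit Types (e : edge n) (phi : vertex n -> R) (F G : real_space R (edge n)).

Definition grad phi : real_space R (edge n) :=
  [ffun e : edge n => phi (Defs.head o e) - phi (tail o e)].

Lemma edge_ends x i :
  (tail o (edge_at x i) = x /\ Defs.head o (edge_at x i) = flip i x) \/
  (tail o (edge_at x i) = flip i x /\ Defs.head o (edge_at x i) = x).
Proof.
have E : [set x; flip i x] = _ := orientationE o (edge_at x i).
have := card_edge (edge_at x i); rewrite (orientationE o) cards2.
have : tail o (edge_at x i) \in [set x; flip i x] by rewrite E !inE eqxx.
have : Defs.head o (edge_at x i) \in [set x; flip i x] by rewrite E !inE eqxx orbT.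
rewrite !inE => /orP[] /eqP -> /orP[] /eqP ->; rewrite ?eqxx //; by [left | right].
Qed.

Lemma tail_eq_head e : (tail o e == Defs.head o e) = false.
Proof.
by have := card_edge e; rewrite (orientationE o) cards2; case: eqP.
Qed.

Lemma normr_grad_edge_at phi x i :
  `|grad phi (edge_at x i)| = `|phi x - phi (flip i x)|.
Proof.
by rewrite ffunE; case: (edge_ends x i) => -[-> ->]; rewrite // distrC.
Qed.

Lemma net_flow_star F x :
  net_flow o F x =
  \sum_i (if Defs.head o (edge_at x i) == x then F (edge_at x i) else - F (edge_at x i)).
Proof.
rewrite -(sum_edges_at (fun e : edge n => if Defs.head o e == x then F e else - F e)).
rewrite ffunE [RHS](bigID (fun e : edge n => Defs.head o e == x)) /= -sumrN; congr (_ + _).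
  apply: eq_big => [e|e /eqP ->]; last by rewrite eqxx.
  by rewrite (orientationE o) !inE; case: eqP => [->|]; rewrite ?eqxx ?orbT ?andbF.
apply: eq_big => [e|e /eqP <-]; last by rewrite eq_sym tail_eq_head.
rewrite (orientationE o) !inE ![x == _]eq_sym.
case: eqP => [<-|_] /=; first by rewrite eq_sym tail_eq_head.
by case: eqP.
Qed.

(** Reversing an edge changes the sign of both its gradient and its incidence at [x], so the
    orientation cancels. *)
Lemma net_flow_grad phi x : net_flow o (grad phi) x = laplacian phi x.
Proof.
rewrite net_flow_star; apply: eq_bigr => i _; rewrite ffunE.
case: (edge_ends x i) => -[-> ->]; last by rewrite eqxx.
by rewrite eq_sym flip_neq opprB.
Qed.

(** Summation by parts: [grad] is the adjoint of [net_flow]. *)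
Lemma dotf_grad phi G : dotf (grad phi) G = \sum_x phi x * net_flow o G x.
Proof.
under [RHS]eq_bigr do rewrite ffunE mulrBr !mulr_sumr.
rewrite sumrB /dotf; under eq_bigr do rewrite ffunE mulrBl.
rewrite sumrB; congr (_ - _).
  rewrite (partition_big (Defs.head o) predT) //=; apply: eq_bigr => x _.
  by apply: eq_bigr => e /eqP ->.
rewrite (partition_big (tail o) predT) //=; apply: eq_bigr => x _.
by apply: eq_bigr => e /eqP ->.
Qed.

Lemma dotfC F G : dotf F G = dotf G F.
Proof. by apply: eq_bigr => i _; rewrite mulrC. Qed.

Lemma cycle_space_net_flow F : (F \in cycle_space R o) = (net_flow o F == 0).
Proof. by rewrite memv_ker lfunE. Qed.

(** By adjointness gradients are orthogonal to cycles, and [F - grad phi] has zero net flow, hence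
    is a cycle. *)
Lemma cut_proj_potential phi F : laplacian phi =1 net_flow o F ->
  cut_proj R o F = grad phi.
Proof.
move=> phiF; apply/esym/ortho_projP; split=> [|G Gcut].
  apply/mem_orthovP => G; rewrite cycle_space_net_flow => /eqP G0.
  by rewrite [LHS]dotf_grad G0 big1 // => x _; rewrite ffunE mulr0.
rewrite dotfC; move/mem_orthovP: Gcut; apply.
rewrite cycle_space_net_flow linearB /= subr_eq0.
by apply/eqP/ffunP => x; rewrite net_flow_grad phiF.
Qed.

Lemma net_flow_basis_vec e x :
  net_flow o (basis_vec R e) x = (x == Defs.head o e)%:R - (x == tail o e)%:R.
Proof.
have sum_eq (P : pred (edge n)) :
    \sum_(e' | P e') basis_vec R e e' = (P e)%:R.
  under eq_bigr do rewrite ffunE.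
  case: (boolP (P e)) => Pe.
    by rewrite (bigD1 e) //= eqxx big1 ?addr0 // => k /andP[_ /negPf ->].
  by rewrite big1 // => k Pk; case: eqP Pe => // <-; rewrite Pk.
by rewrite ffunE !sum_eq ![x == _]eq_sym.
Qed.

Lemma l1norm_cut_proj_basis_vec e :
  l1norm (cut_proj R o (basis_vec R e)) = (n%:R + 1) / 2.
Proof.
have : Defs.head o e \in val e by rewrite (orientationE o) !inE eqxx orbT.
move=> /edge_atP[j ej].
have tE : tail o e = flip j (Defs.head o e).
  by case: (edge_ends (Defs.head o e) j); rewrite -ej => -[// tE _];
    have := tail_eq_head e; rewrite tE eqxx.
have [phi phi_anti phi_lap] := dipole_potential R (Defs.head o e) j.
rewrite (@cut_proj_potential phi) => [|x]; last first.
  by rewrite phi_lap net_flow_basis_vec tE.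
(* Twice the l1-norm splits by direction: 2 from [j] and 1 from each of the other [n - 1]
   directions. *)
have := sum_edges (fun e : edge n => `|grad phi e|).
under [RHS]eq_bigr do under eq_bigr do rewrite normr_grad_edge_at.
rewrite exchange_big (bigD1 j) //= => E.
have := dipole_potential_grad j phi_anti phi_lap; rewrite eqxx mulr1n => Ej.
(* Positivity lets the truncated predecessor of [n], which counts the other directions, be cast to
   [n%:R - 1]. *)
have n_gt0 : (0 < n)%N by apply: leq_trans (ltn_ord j).
have Ei : \sum_(i | i != j) \sum_x `|phi x - phi (flip i x)| = n%:R - 1.
  rewrite (eq_bigr (fun=> 1)) => [|i ij].
    by rewrite sumr_const cardC1 card_ord -subn1 natrB.
  have := dipole_potential_grad i phi_anti phi_lap.
  by rewrite ij /= mulr2n; lra.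
by move: E; rewrite Ej Ei /l1norm mulr2n; lra.
Qed.

End Gradient.

Theorem theorem45 (R : realType) (n : nat) (hn : (1 <= n)%N) (o : orientation n) :
  l1opnorm (cut_proj R o) = (n%:R + 1) / 2.
Proof.
(* The hypothesis [hn] supplies a direction, hence an edge at the zero vertex. *)
apply: (l1opnorm_columns (edge_at [ffun=> false] (Ordinal hn))) => e.
exact: l1norm_cut_proj_basis_vec.
Qed.
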